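(* Let $T=T^2$, let $a,b,c\in H^2(BT)$ generate $H^2(BT)$, and let $M$ be a $6$-dimensional GKM manifold with $T$-action whose fixed points are $p_1,p_2,p_3,p_4$ and whose GKM graph has exactly the following edges (up to orientation), with ''$p\to q:\ w$'' meaning an edge from $p$ to $q$ with label $w$: $p_2\to p_1: a$; $p_3\to p_1: b$; $p_4\to p_1: c$; $p_2\to p_3: a-b$; $p_3\to p_4: b-c$; $p_4\to p_2: c-a$. Let $\xi\in H^2_T(M)$ be the element whose restrictions to $p_1,p_2,p_3,p_4$ are $0,a,b,c$ respectively. Then $$H^*_T(M)=H^*(BT)[\xi]/\big(\xi(\xi-a)(\xi-b)(\xi-c)\big).$$
   Context: $T$ is a compact torus; $H^2(BT)=H^2(BT;\mathbb Z)$ is identified with $\mathrm{Hom}(T,S^1)$, and $\chi^u:T\to S^1$ is the homomorphism corresponding to $u$. A GKM manifold is a connected compact almost complex manifold $(M,J)$ with a $T$-action preserving $J$ such that $M^T$ is finite, the weights of the $T$-module $T_pM$ are pairwise linearly independent for every $p\in M^T$, and $H^{\mathrm{odd}}(M)=0$. Its GKM graph has vertex set $M^T$; for $p\in M^T$ and a weight $u$ of $T_pM$, the component of $M^{\ker\chi^u}$ through $p$ is a $2$-sphere containing one further fixed point $q$, and it gives an edge between $p$ and $q$ with label $u$ when oriented from $p$ to $q$ and $-u$ when oriented from $q$ to $p$. The equivariant cohomology $H_T^*(M)$ is identified (a known result, used throughout) with the graph cohomology, i.e. the ring of maps $\eta:M^T\to H^*(BT)$ with $\eta(p)\equiv\eta(q)$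 modulo the label of $e$ for every edge $e$ from $p$ to $q$; the identification is by restriction to fixed points. *)

(* Defs.v *)
From HB Require Import structures.
From mathcomp Require Import all_boot all_order all_algebra.
From mathcomp Require Import boolp.
From mathcomp Require Import mpoly.

Set Implicit Arguments.
Unset Strict Implicit.
Unset Printing Implicit Defensive.

Import GRing.Theory.
Local Open Scope ring_scope.

(* T = (S^1)^n, so H^2(BT) = Hom(T, S^1) = Z^n and H^*(BT), the symmetric
   algebra on H^2(BT), is Z[X_0, ..., X_(n-1)]; a class of cohomological degree
   2k is a homogeneous polynomial of degree k. *)
Notation H2BT n := 'rV[int]_n.
Notation HBT n := {mpoly int[n]}.

Definition cls n (u : H2BT n) : HBT n := \sum_(i < n) u 0 i *: 'X_i.

Definition lin_indep2 n (u v : H2BT n) :=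
  forall k l : int, u *~ k + v *~ l = 0 -> k = 0 /\ l = 0.

(* The fixed point data of a GKM manifold M of dimension 2m with an action of
   T = (S^1)^n.  [weights p] lists the weights of T_pM and, for a weight u of
   T_pM, [opp p u] is the fixed point other than p on the 2-sphere that is the
   component of M^(ker chi^u) through p; the tangent space of that sphere has
   weight u at p and weight -u at the other fixed point. Only the values of
   [opp p] on [weights p] are meaningful. *)
Record gkmGraph (n m : nat) := GKMGraph {
  fixpt : finType;
  weights : fixpt -> seq (H2BT n);
  opp : fixpt -> H2BT n -> fixpt;
  fixpt_nonempty : (0 < #|fixpt|)%N;
  size_weights : forall p, size (weights p) = m;
  weights_uniq : forall p, uniq (weights p);
  weights_neq0 : forall p, 0 \notin weights p;
  weights_indep : forall p, {in weights p &, forall u v,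
    u != v -> lin_indep2 u v};
  opp_neq : forall p, {in weights p, forall u, opp p u != p};
  opp_weights : forall p, {in weights p, forall u, - u \in weights (opp p u)};
  oppK : forall p, {in weights p, forall u, opp (opp p u) (- u) = p};
  fixpt_connected : forall p q,
    connect [rel x y | has (fun u => opp x u == y) (weights x)] p q
}.

Arguments weights {n m g} p.
Arguments opp {n m g} p u.

(* There is an edge from p to q with label u. By [opp_weights] and [oppK] this
   is equivalent to the existence of an edge from q to p with label -u. *)
Definition gkm_edge n m (M : gkmGraph n m) (p q : fixpt M) (u : H2BT n) : bool :=
  (u \in weights p) && (opp p u == q).

Definition gkm_cong n m (M : gkmGraph n m) (eta : {ffun fixpt M -> HBT n}) :=
  forall p q u, gkm_edge p q u ->
    exists g : HBT n, eta p - eta q = g * cls u.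

(* As H^odd(M) = 0, restriction to the fixed points identifies H_T^*(M) with the
   graph cohomology, which is taken here as its definition ([HT] below). *)
Definition gkm_class n m (M : gkmGraph n m) : pred {ffun fixpt M -> HBT n} :=
  fun eta => `[< gkm_cong eta >].

Arguments gkm_class {n m} M _.

Section EquivariantCohomology.
Variables (n m : nat) (M : gkmGraph n m).

Fact gkm_class_subring : subring_closed (gkm_class M).
Proof.
split=> [|x y /asboolP cx /asboolP cy|x y /asboolP cx /asboolP cy]; apply/asboolP=> p q u e.
- by exists 0; rewrite !ffunE subrr mul0r.
- have [g xg] := cx _ _ _ e; have [h yh] := cy _ _ _ e.
  by exists (g - h); rewrite !ffunE mulrBl -xg -yh opprD addrACA -opprD.
have [g xg] := cx _ _ _ e; have [h yh] := cy _ _ _ e.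
exists (g * y p + x q * h).
rewrite !ffunE mulrDl -[x q * h * _]mulrA -yh mulrAC -xg mulrBl mulrBr.
by rewrite addrA subrK.
Qed.

HB.instance Definition _ :=
  GRing.isSubringClosed.Build _ (gkm_class M) gkm_class_subring.

Record HT : predArgType := MkHT {
  restr :> {ffun fixpt M -> HBT n};
  _ : restr \in gkm_class M
}.

HB.instance Definition _ := [isSub for restr].
HB.instance Definition _ := [Choice of HT by <:].
HB.instance Definition _ := 
  GRing.SubChoice_isSubPzRing.Build _ (gkm_class M) HT gkm_class_subring.

Fact HT_mulC : commutative (@GRing.mul HT).
Proof. by move=> x y; apply/val_inj/ffunP=> p; rewrite !ffunE mulrC. Qed.
HB.instance Definition _ := GRing.PzRing_hasCommutativeMul.Build HT HT_mulC.

Fact HT_oner_neq0 : (1 : HT) != 0.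
Proof.
have /card_gt0P[p _] := fixpt_nonempty M.
by apply/eqP=> /(congr1 (fun x : HT => restr x p))/eqP; rewrite !ffunE oner_eq0.
Qed.
HB.instance Definition _ := GRing.PzSemiRing_isNonZero.Build HT HT_oner_neq0.

Fact gkm_class_const (k : HBT n) : [ffun=> k] \in gkm_class M.
Proof. by apply/asboolP=> p q u _; exists 0; rewrite !ffunE subrr mul0r. Qed.

(* The structure map H^*(BT) -> H_T^*(M). *)
Definition HT_const (k : HBT n) : HT := MkHT (gkm_class_const k).
Definition HT_scale (k : HBT n) (x : HT) : HT := HT_const k * x.

Fact HT_const1 : HT_const 1 = 1.
Proof. exact/val_inj. Qed.
Fact HT_constM k l : HT_const (k * l) = HT_const k * HT_const l.
Proof. by apply/val_inj/ffunP=> p /=; rewrite [LHS]ffunE [RHS]ffunE !ffunE. Qed.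
Fact HT_constD k l : HT_const (k + l) = HT_const k + HT_const l.
Proof. by apply/val_inj/ffunP=> p /=; rewrite [LHS]ffunE [RHS]ffunE !ffunE. Qed.

Fact HT_scaleA k l x : HT_scale k (HT_scale l x) = HT_scale (k * l) x.
Proof. by rewrite /HT_scale HT_constM mulrA. Qed.
Fact HT_scale1 : left_id 1 HT_scale.
Proof. by move=> x; rewrite /HT_scale HT_const1 mul1r. Qed.
Fact HT_scaleDr : right_distributive HT_scale +%R.
Proof. by move=> k x y; rewrite /HT_scale mulrDr. Qed.
Fact HT_scaleDl x : {morph HT_scale^~ x : k l / k + l}.
Proof. by move=> k l; rewrite /HT_scale HT_constD mulrDl. Qed.
HB.instance Definition _ := GRing.Zmodule_isLmodule.Build (HBT n) HT
  HT_scaleA HT_scale1 HT_scaleDr HT_scaleDl.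

Fact HT_scaleAl k (x y : HT) : k *: (x * y) = k *: x * y.
Proof. exact: mulrA. Qed.
HB.instance Definition _ := GRing.Lmodule_isLalgebra.Build (HBT n) HT HT_scaleAl.

Fact HT_scaleAr k (x y : HT) : k *: (x * y) = x * (k *: y).
Proof. exact: mulrCA. Qed.
HB.instance Definition _ := GRing.Lalgebra_isAlgebra.Build (HBT n) HT HT_scaleAr.

(* [x \in H_T^(2k)(M)] *)
Definition HT_homog (k : nat) (x : HT) : Prop :=
  forall p, restr x p \is k.-homog.

End EquivariantCohomology.

Definition relpoly n (a b c : H2BT n) : {poly HBT n} :=
  'X * ('X - (cls a)%:P) * ('X - (cls b)%:P) * ('X - (cls c)%:P).

Fact mk_monic_quartic (R : idomainType) (x y z : R) :
  let h := 'X * ('X - x%:P) * ('X - y%:P) * ('X - z%:P) in mk_monic h = h.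
Proof.
move=> h; have hm : h \is monic by rewrite !monicMl ?monicX ?monicXsubC.
rewrite /mk_monic hm !size_Mmonic ?monicXsubC ?mulf_neq0 ?polyXsubC_eq0
  ?polyX_eq0 //.
by rewrite size_polyX 3!size_XsubC.
Qed.

(* [{poly %/ h}] is the quotient by [mk_monic h], which is a dummy value unless
   h is monic and non constant; this shows that here it is h itself. *)
Fact mk_monic_relpoly n (a b c : H2BT n) :
  mk_monic (relpoly a b c) = relpoly a b c.
Proof. exact: mk_monic_quartic. Qed.

(* Main.v *)
Require Import Defs.
From HB Require Import structures.
From mathcomp Require Import all_boot all_order all_algebra.
From mathcomp Require Import mpoly.
From mathcomp Require Import ring lra zify.

Set Implicit Arguments.
Unset Strict Implicit.
Unset Printing Implicit Defensive.

Import GRing.Theory.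
Local Open Scope ring_scope.

(* An element of Z[X_0, X_1] that is divisible by several pairwise coprime weights
   is divisible by their product; the weights at a fixed point are pairwise
   coprime because they are linearly independent and, as a, b, c generate
   H^2(BT), no prime divides two of them. Hence the restrictions to p1, ..., p4
   of every class are the values at 0, a, b, c of a Newton polynomial over H^*(BT),
   which gives surjectivity of evaluation at xi; injectivity holds because a
   nonzero polynomial of degree at most 3 cannot vanish at the four distinct
   elements 0, a, b, c of a domain. *)

Definition divides (R : pzRingType) (d x : R) := exists g, x = g * d.

Lemma mpoly_modX (n : nat) (R : comNzRingType) (i : 'I_n) (h : {mpoly R[n]}) :
  exists q, h = q * 'X_i +
    (h \mPo [tuple if j == i then 0 else 'X_j | j < n]).
Proof.
elim/mpolyind: h => [|c m p _ _ [q IH]].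
  by exists 0; rewrite comp_mpoly0 mul0r addr0.
suff [r Er] : exists r, 'X_[m] = r * 'X_i +
    (('X_[m] : {mpoly R[n]}) \mPo [tuple if j == i then 0 else 'X_j | j < n]).
  exists (c *: r + q); rewrite comp_mpolyD comp_mpolyZ {1}IH {1}Er.
  by rewrite mulrDl scalerDr -scalerAl !addrA; congr (_ + _); rewrite addrAC.
rewrite comp_mpolyX; have [mi0|mi_gt0] := posnP (m i).
  exists 0; rewrite mul0r add0r mpolyXE_id; apply: eq_bigr => j _.
  by rewrite tnth_mktuple; case: eqP => // ->; rewrite mi0 !expr0.
exists 'X_[m - U_(i)].
rewrite (bigD1 i) //= tnth_mktuple eqxx expr0n gtn_eqF // mul0r addr0.
rewrite -mpolyXD submK //; apply/mnm_lepP => j; rewrite mnm1E.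
by case: eqP => [<-|].
Qed.

Lemma dividesX_mulX (n : nat) (R : idomainType) (i j : 'I_n)
    (h : {mpoly R[n]}) : i != j -> divides 'X_i (h * 'X_j) -> divides 'X_i h.
Proof.
move=> neq_ij [k /(congr1 (comp_mpoly
  [tuple if l == i then 0 else 'X_l | l < n]))].
rewrite !rmorphM /= !comp_mpolyXU -!tnth_nth !tnth_mktuple eqxx eq_sym.
rewrite (negPf neq_ij) mulr0 => /eqP; rewrite mulf_eq0 => /orP[/eqP h0|].
  by have [q {1}->] := mpoly_modX i h; exists q; rewrite h0 addr0.
by move/eqP/(congr1 (mcoeff U_(j)%MM))/eqP; rewrite mcoeffX mcoeff0 eqxx oner_eq0.
Qed.

Lemma mpoly_natr_neq0 (n p : nat) : (0 < p)%N -> p%:R != 0 :> {mpoly int[n]}.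
Proof.
move=> p_gt0; apply/eqP => /(congr1 (mcoeff 0%MM)).
by rewrite -mpolyC_nat mcoeffC eqxx mulr1 mcoeff0; lia.
Qed.

Lemma divides_natP (n p : nat) (g : {mpoly int[n]}) : prime p ->
  divides p%:R g <-> forall m, (g@_m)%:~R = 0 :> 'F_p.
Proof.
move=> pr_p; split=> [[h ->] m|g0].
  apply/eqP; rewrite -(dvdz_pcharf (pchar_Fp pr_p)) mulr_natr mcoeffMn.
  by rewrite -mulr_natr natz dvdz_mull.
have dvd_g m : (p %| g@_m)%Z by rewrite (dvdz_pcharf (pchar_Fp pr_p)) g0.
exists (\sum_(m <- msupp g) (g@_m %/ p)%Z *: 'X_[m]).
rewrite {1}[g]mpolyE mulr_suml; apply: eq_bigr => m _.
by rewrite mulr_natr scalerMnl -[X in _ = X *: _]mulr_natr natz divzK.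
Qed.

Lemma prime_dividesM (n p : nat) (f g : {mpoly int[n]}) : prime p ->
  divides p%:R (f * g) -> divides p%:R f \/ divides p%:R g.
Proof.
move=> pr_p; rewrite !divides_natP //.
pose red : {mpoly int[n]} -> {mpoly 'F_p[n]} := map_mpoly intr.
have redE h m : (red h)@_m = (h@_m)%:~R by exact: mcoeff_map_mpoly.
have redM : red (f * g) = red f * red g by exact: rmorphM.
have red0 h : (red h = 0) <-> (forall m, (h@_m)%:~R = 0 :> 'F_p).
  split=> [h0 m|h0]; first by rewrite -redE h0 mcoeff0.
  by apply/mpolyP => m; rewrite redE h0 mcoeff0.
rewrite -!red0 redM => /eqP; rewrite mulf_eq0.
by move=> /orP[] /eqP ->; [left | right].
Qed.

(* Strong induction on D + |u_m|: a prime p dividing D divides either the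
   cofactor of u in g * D, and is cancelled from D, or u, and then also g,
   and is cancelled from both. *)
Lemma divides_cancel_nat (n D : nat) (u v g : {mpoly int[n]}) :
    u != 0 -> (0 < D)%N ->
    (forall p, prime p -> divides p%:R u -> ~ divides p%:R v) ->
  divides u (v * g) -> divides u (g * D%:R) -> divides u g.
Proof.
move=> /[dup] u_neq0; rewrite -msupp_eq0; case E: (msupp u) => [//|m s] _.
have {E s}: u@_m != 0 by rewrite -mcoeff_msupp E mem_head.
have [N] := ubnP (D + `|u@_m|).
elim: N D u g u_neq0 => // N IH D u g u_neq0 ltDN um0 D_gt0 uv.
move=> [h vgE] [k gDE].
have [D1|D_neq1] := eqVneq D 1%N; first by exists k; rewrite -gDE D1 mulr1.
have pr_p : prime (pdiv D) by apply: pdiv_prime; lia.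
have [D' DE] : exists D', D = (D' * pdiv D)%N.
  by exists (D %/ pdiv D)%N; rewrite divnK // pdiv_dvd.
set p := pdiv D in pr_p DE; have p_gt1 := prime_gt1 pr_p.
have p_neq0 := mpoly_natr_neq0 n (prime_gt0 pr_p).
have : divides p%:R (k * u) by exists (g * D'%:R); rewrite -gDE DE natrM mulrA.
case/(prime_dividesM pr_p) => [[k' kE]|pu].
  apply: (IH D') => //; [nia | nia | by exists h |].
  exists k'; apply: (mulIf p_neq0).
  by rewrite -mulrA -natrM -DE gDE kE mulrAC.
have [u' uE] := pu.
have [g' gE] : divides p%:R g.
  have : divides p%:R (v * g) by exists (h * u'); rewrite vgE uE mulrA.
  by case/(prime_dividesM pr_p) => // /(uv _ pr_p pu).
have umE : u@_m = u'@_m * p%:Z by rewrite uE mulr_natr mcoeffMn -mulr_natr natz.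
have um'0 : u'@_m != 0 by apply: contraNneq um0 => u'0; rewrite umE u'0 mul0r.
have [t tE] : divides u' g'.
  apply: (IH D) => //.
  - by apply: contraNneq u_neq0 => u'0; rewrite uE u'0 mul0r.
  - move: um'0 ltDN; rewrite umE abszM -absz_gt0 /=.
    move: `|_|%N => x; nia.
  - move=> q pr_q [u'' u'E]; apply: uv => //.
    by exists (u'' * p%:R); rewrite uE u'E mulrAC.
  - by exists h; apply: (mulIf p_neq0); rewrite -!mulrA -gE -uE.
  by exists k; apply: (mulIf p_neq0); rewrite mulrAC -gE -mulrA -uE.
by exists t; rewrite gE uE tE mulrA.
Qed.

Section LinearForms.
Variable n : nat.
Implicit Types u v : H2BT n.

Lemma clsB u v : cls (u - v) = cls u - cls v.
Proof.
rewrite -sumrB; apply: eq_bigr => i _.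
by rewrite !mxE scalerBl.
Qed.

Lemma clsN u : cls (- u) = - cls u.
Proof. by rewrite -sumrN; apply: eq_bigr => i _; rewrite mxE scaleNr. Qed.

Lemma mcoeff_cls u (i : 'I_n) : (cls u)@_U_(i) = u 0 i.
Proof.
rewrite raddf_sum /= (bigD1 i) //= big1 => [|j /negPf neq_ji].
  by rewrite mcoeffZ mcoeffXU eqxx mulr1 addr0.
by rewrite mcoeffZ mcoeffXU neq_ji mulr0.
Qed.

Lemma cls_eq0 u : (cls u == 0) = (u == 0).
Proof.
apply/eqP/eqP => [u0|->].
  by apply/rowP => i; rewrite -mcoeff_cls u0 mcoeff0 mxE.
by rewrite /cls big1 // => i _; rewrite mxE scale0r.
Qed.

Lemma cls_homog u : cls u \is 1.-homog.
Proof.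
by apply: rpred_sum => i _; apply: rpredZ; rewrite dhomogX /= mdeg1.
Qed.

End LinearForms.

Lemma ord2_cases (i : 'I_2) : i = 0 \/ i = 1.
Proof. by case: i => [[|[|//]] lti]; [left | right]; apply: val_inj. Qed.

Lemma cls2E (u : H2BT 2) : cls u = (u 0 0)%:MP * 'X_0 + (u 0 1)%:MP * 'X_1.
Proof.
rewrite /cls !big_ord_recl big_ord0 addr0 !mul_mpolyC.
by have -> : lift ord0 ord0 = 1 :> 'I_2 by exact: val_inj.
Qed.

Lemma det_lin_indep2 (u v : H2BT 2) : lin_indep2 u v ->
  u 0 0 * v 0 1 - u 0 1 * v 0 0 != 0.
Proof.
move=> uv; apply/eqP => D0.
have rel (i : 'I_2) : u *~ (v 0 i) + v *~ (- u 0 i) = 0.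
  rewrite -!scaler_int !intz; apply/rowP => j; rewrite !mxE.
  case: (ord2_cases i) => ->; case: (ord2_cases j) => ->; lra.
have u0 i : u 0 i = 0 by have [_] := uv _ _ (rel i); lia.
have u_eq0 : u = 0 by apply/rowP => i; rewrite u0 mxE.
by have [] := uv 1 0; rewrite // u_eq0 mul0rz mulr0z addr0.
Qed.

Lemma divides_clsM (u v w : H2BT 2) (g : HBT 2) :
    lin_indep2 u v ->
    (forall x : H2BT 2, exists k l m : int, x = k *: u + l *: v + m *: w) ->
  divides (cls u) (g * cls v) -> divides (cls u) g.
Proof.
move=> /det_lin_indep2; set D := _ - _ => D_neq0 span [h vgE].
have u_neq0 : cls u != 0.
  rewrite cls_eq0; apply: contraNneq D_neq0 => u0.
  by rewrite /D u0 !mxE !mul0r subrr.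
have coprime_uv p : prime p -> divides p%:R (cls u) -> ~ divides p%:R (cls v).
  move=> pr_p /divides_natP-/(_ pr_p) up /divides_natP-/(_ pr_p) vp.
  have red (x : H2BT 2) : exists m : 'F_p, forall i : 'I_2,
      (x 0 i)%:~R = m * (w 0 i)%:~R.
    have [k [l [m ->]]] := span x; exists m%:~R => i.
    have {up} := up U_(i)%MM; have {vp} := vp U_(i)%MM.
    rewrite !mcoeff_cls !mxE !rmorphD !rmorphM /= => -> ->.
    by rewrite !mulr0 !add0r.
  have [m e0] := red (delta_mx 0 0); have [l e1] := red (delta_mx 0 1).
  have := e0 0; have := e0 1; have := e1 0; have := e1 1.
  rewrite !mxE /= => l1 l0 m1 m0.
  suff : (1 : 'F_p) = 0 by apply/eqP/oner_neq0.
  have -> : 1 = (l * (w 0 1)%:~R) * (m * (w 0 0)%:~R) by rewrite -l1 -m0 mulr1.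
  by rewrite mulrACA [(w 0 1)%:~R * _]mulrC -mulrACA -l0 mul0r.
(* Eliminating X_1, then X_0, from u and v shows that u divides g * D * X_0
   and g * D * X_1, with cofactors h0 and h1. *)
pose h0 := (v 0 1)%:MP * g - (u 0 1)%:MP * h : HBT 2.
pose h1 := (u 0 0)%:MP * h - (v 0 0)%:MP * g : HBT 2.
have E0 : g * D%:MP * 'X_0 = h0 * cls u.
  rewrite /h0 mulrBl -mulrA -[_ * h * _]mulrA -vgE !cls2E /D mpolyCB !mpolyCM.
  by ring.
have E1 : g * D%:MP * 'X_1 = h1 * cls u.
  rewrite /h1 mulrBl -mulrA -[_ * h * _]mulrA -vgE !cls2E /D mpolyCB !mpolyCM.
  by ring.
have [k kE] : divides ('X_0 : HBT 2) h0.
  apply: (@dividesX_mulX 2 int 0 1) => //; exists h1; apply: (mulIf u_neq0).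
  by rewrite mulrAC -E0 [RHS]mulrAC -E1 mulrAC.
have X0_neq0 : 'X_0 != 0 :> HBT 2.
  by apply/eqP=> /(congr1 (mcoeff U_(0%R)%MM))/eqP; rewrite mcoeffXU mcoeff0 eqxx.
have gDE : g * D%:MP = k * cls u.
  by apply: (mulIf X0_neq0); rewrite E0 kE mulrAC.
apply: (@divides_cancel_nat _ `|D| (cls u) (cls v)) => //.
- by rewrite absz_gt0.
- by exists h; rewrite mulrC.
exists (((-1) ^+ (D < 0)%R)%:MP * k).
by rewrite -mpolyC_nat natz abszE Num.Theory.normrEsign mpolyCM mulrCA gDE mulrA.
Qed.

Lemma qpoly_lift (A : comNzRingType) (h : {poly A}) (B : algType A) (x : B) :
    horner_alg x (mk_monic h) = 0 ->
  exists f : {lrmorphism {poly %/ h} -> B},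
    forall p, f (in_qpoly h p) = horner_alg x p.
Proof.
move=> hx0; pose f (q : {poly %/ h}) := horner_alg x (q : {poly A}).
have fE p : f (in_qpoly h p) = horner_alg x p.
  rewrite {2}(Pdiv.RingMonic.rdivp_eq (monic_mk_monic h) p).
  by rewrite rmorphD rmorphM /= hx0 mulr0 add0r.
have f_add : zmod_morphism f by move=> p q; rewrite /f -rmorphB.
have f_mul : monoid_morphism f.
  split; first by rewrite -(in_qpoly1 h) fE rmorph1.
  by move=> p q; rewrite -[_ * _]/(in_qpoly h _) fE rmorphM.
have f_scal : scalable f.
  by move=> k p; rewrite /f poly_of_qpolyZ -mul_polyC rmorphM /= horner_algC mulr_algl.
pose F : {lrmorphism {poly %/ h} -> B} := HB.pack f
  (GRing.isZmodMorphism.Build _ _ f f_add)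
  (GRing.isMonoidMorphism.Build _ _ f f_mul)
  (GRing.isScalable.Build _ _ _ _ f f_scal).
by exists F.
Qed.

Section GraphClasses.
Variables (n m : nat) (M : gkmGraph n m).
Implicit Types x y : HT M.

Lemma restrD x y p : restr (x + y) p = restr x p + restr y p.
Proof. by rewrite ffunE. Qed.

Lemma restrM x y p : restr (x * y) p = restr x p * restr y p.
Proof. by rewrite ffunE. Qed.

Lemma restrC (k : HBT n) p : restr (k%:A : HT M) p = k.
Proof. by rewrite -[k%:A]/(HT_const M k * 1) mulr1 ffunE. Qed.

Lemma restr_horner x (q : {poly HBT n}) p :
  restr (horner_alg x q) p = q.[restr x p].
Proof.
elim/poly_ind: q => [|q k IH]; first by rewrite rmorph0 horner0 ffunE.
have -> : horner_alg x (q * 'X + k%:P) = horner_alg x q * x + k%:A.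
  by rewrite rmorphD rmorphM /= horner_algX horner_algC.
by rewrite restrD restrM restrC IH hornerMXaddC.
Qed.

Lemma HT_cong x p q u : gkm_edge p q u -> divides (cls u) (x p - x q).
Proof. by case: x => x /= /boolp.asboolP xP e; apply: xP. Qed.

Lemma gkm_edge_neq0 (p q : fixpt M) u : gkm_edge p q u -> u != 0.
Proof. by case/andP=> uP _; apply: contraTneq uP => ->; exact: weights_neq0. Qed.

Lemma gkm_edge_indep (p q r : fixpt M) u v :
  gkm_edge p q u -> gkm_edge p r v -> u != v -> lin_indep2 u v.
Proof. by case/andP=> uP _ /andP[vP _]; apply: (weights_indep uP vP). Qed.

End GraphClasses.

Lemma horner_quartic (R : comNzRingType) (a b c x : R) :
  ('X * ('X - a%:P) * ('X - b%:P) * ('X - c%:P)).[x] =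
    x * (x - a) * (x - b) * (x - c).
Proof. by rewrite !hornerM !hornerXsubC hornerX. Qed.

Lemma horner_relpoly n (a b c : H2BT n) x :
  (relpoly a b c).[x] = x * (x - cls a) * (x - cls b) * (x - cls c).
Proof. exact: horner_quartic. Qed.

Lemma size_quartic (R : idomainType) (a b c : R) :
  size ('X * ('X - a%:P) * ('X - b%:P) * ('X - c%:P)) = 5.
Proof.
rewrite !size_Mmonic ?monicXsubC ?mulf_neq0 ?polyXsubC_eq0 ?polyX_eq0 //.
by rewrite size_polyX !size_XsubC.
Qed.

(* Newton interpolation at the nodes 0, a, b, c: the divisibilities make the
   divided differences lie in R. *)
Lemma newton_interpolation (R : comNzRingType) (a b c y1 y2 y3 y4 : R) :
    (forall g, divides b (g * (b - a)) -> divides b g) ->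
    (forall g, divides c (g * (c - a)) -> divides c g) ->
    (forall g, divides c (g * (c - b)) -> divides c g) ->
    (forall g, divides (c - a) (g * (c - b)) -> divides (c - a) g) ->
    divides a (y2 - y1) -> divides b (y3 - y1) -> divides c (y4 - y1) ->
    divides (b - a) (y3 - y2) -> divides (c - b) (y4 - y3) ->
    divides (c - a) (y4 - y2) ->
  exists q : {poly R}, [/\ q.[0] = y1, q.[a] = y2, q.[b] = y3 & q.[c] = y4].
Proof.
move=> b_ba c_ca c_cb ca_cb [g1 e12] [k13 e13] [k14 e14].
move=> [k23 e23] [k34 e34] [k24 e24].
have y2E : y2 = y1 + g1 * a by rewrite -e12 addrC subrK.
have [g2 g2E] : divides b (k23 - g1).
  apply: b_ba; exists (k13 - g1).
  by rewrite !mulrBl -e13 -e23 y2E; ring.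
have y3E : y3 = y1 + g1 * b + g2 * b * (b - a).
  by rewrite -g2E mulrBl -e23 y2E; ring.
have z4E : (k34 - g1 - g2 * (c + b - a)) * (c - b) =
    y4 - y1 - g1 * c - g2 * c * (c - a).
  by rewrite !mulrBl -e34 y3E; ring.
have [h hE] : divides (c - a) (k34 - g1 - g2 * (c + b - a)).
  apply: ca_cb; exists (k24 - g1 - g2 * c).
  by rewrite z4E [RHS]mulrBl mulrBl -e24 y2E; ring.
have [g3 g3E] : divides c h.
  apply/c_ca/c_cb; exists (k14 - g1 - g2 * (c - a)).
  by rewrite -hE z4E [RHS]mulrBl mulrBl -e14; ring.
exists (y1%:P + g1%:P * 'X + g2%:P * 'X * ('X - a%:P)
        + g3%:P * 'X * ('X - a%:P) * ('X - b%:P)).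
split; rewrite !hornerE //.
- by rewrite y2E; ring.
- by rewrite y3E; ring.
by rewrite -g3E -hE z4E; ring.
Qed.

Theorem mainTheorem3 (M : gkmGraph 2 3) (a b c : H2BT 2)
    (p1 p2 p3 p4 : fixpt M)
    (abc_generate : forall u : H2BT 2, inIntSpan [tuple a; b; c] u)
    (fixpts_distinct : uniq [:: p1; p2; p3; p4])
    (fixpts_all : forall p : fixpt M, p \in [:: p1; p2; p3; p4])
    (edges : let E := [:: (p2, p1, a); (p3, p1, b); (p4, p1, c);
                          (p2, p3, a - b); (p3, p4, b - c); (p4, p2, c - a)] in
       forall (p q : fixpt M) (w : H2BT 2),
         gkm_edge p q w = ((p, q, w) \in E) || ((q, p, - w) \in E)) :
  exists xi : HT M,
    unique (fun eta : HT M => HT_homog 1 eta /\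
      [/\ eta p1 = 0, eta p2 = cls a, eta p3 = cls b & eta p4 = cls c]) xi
    /\ exists f : {lrmorphism {poly %/ relpoly a b c} -> HT M},
         bijective f /\ f 'qX = xi.
Proof.
have edgeE (p q : fixpt M) w : (p, q, w) \in [:: (p2, p1, a); (p3, p1, b);
    (p4, p1, c); (p3, p2, b - a); (p4, p3, c - b); (p4, p2, c - a)] ->
  gkm_edge p q w.
  rewrite edges !inE => /or4P[|||/or3P[]] /eqP[-> -> ->];
    by rewrite ?opprB eqxx ?orbT.
have e21 : gkm_edge p2 p1 a by apply: edgeE; rewrite !inE eqxx ?orbT.
have e31 : gkm_edge p3 p1 b by apply: edgeE; rewrite !inE eqxx ?orbT.
have e41 : gkm_edge p4 p1 c by apply: edgeE; rewrite !inE eqxx ?orbT.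
have e32 : gkm_edge p3 p2 (b - a) by apply: edgeE; rewrite !inE eqxx ?orbT.
have e43 : gkm_edge p4 p3 (c - b) by apply: edgeE; rewrite !inE eqxx ?orbT.
have e42 : gkm_edge p4 p2 (c - a) by apply: edgeE; rewrite !inE eqxx ?orbT.
have [a0 b0 c0] : [/\ a != 0, b != 0 & c != 0].
  by rewrite (gkm_edge_neq0 e21) (gkm_edge_neq0 e31) (gkm_edge_neq0 e41).
have [ba0 cb0 ca0] : [/\ b - a != 0, c - b != 0 & c - a != 0].
  by rewrite (gkm_edge_neq0 e32) (gkm_edge_neq0 e43) (gkm_edge_neq0 e42).
have span x : exists k l m : int, x = k *: a + l *: b + m *: c.
  have [z ->] := abc_generate x; exists (z 0), (z 1), (z 2).
  rewrite !big_ord_recl big_ord0 addr0 /= !addrA -!scaler_int !intz.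
  by congr (_ *: _ + _ *: _ + _ *: _); congr (z _); apply: val_inj.
have b_ba g : divides (cls b) (g * cls (b - a)) -> divides (cls b) g.
  apply: (@divides_clsM _ _ c); first apply: (gkm_edge_indep e31 e32).
    by rewrite -subr_eq0 opprB addrC subrK.
  move=> x; have [k [l [m ->]]] := span x; exists (l + k), (- k), m.
  by apply/rowP => i; rewrite !mxE; ring.
have c_ca g : divides (cls c) (g * cls (c - a)) -> divides (cls c) g.
  apply: (@divides_clsM _ _ b); first apply: (gkm_edge_indep e41 e42).
    by rewrite -subr_eq0 opprB addrC subrK.
  move=> x; have [k [l [m ->]]] := span x; exists (m + k), (- k), l.
  by apply/rowP => i; rewrite !mxE; ring.
have c_cb g : divides (cls c) (g * cls (c - b)) -> divides (cls c) g.
  apply: (@divides_clsM _ _ a); first apply: (gkm_edge_indep e41 e43).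
    by rewrite -subr_eq0 opprB addrC subrK.
  move=> x; have [k [l [m ->]]] := span x; exists (m + l), (- l), k.
  by apply/rowP => i; rewrite !mxE; ring.
have ca_cb g : divides (cls (c - a)) (g * cls (c - b)) -> divides (cls (c - a)) g.
  apply: (@divides_clsM _ _ c); first apply: (gkm_edge_indep e42 e43).
    by rewrite -subr_eq0 opprB addrC addrA subrK.
  move=> x; have [k [l [m ->]]] := span x; exists (- k), (- l), (m + k + l).
  by apply/rowP => i; rewrite !mxE; ring.
have [[n12 n13 n14] [n23 n24 n34]] :
    [/\ p2 != p1, p3 != p1 & p4 != p1] /\ [/\ p3 != p2, p4 != p2 & p4 != p3].
  move: fixpts_distinct; rewrite /= !inE !negb_or !andbT.
  by rewrite ![p1 == _]eq_sym ![p2 == p3]eq_sym ![p2 == p4]eq_sym ![p3 == p4]eq_sym;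
    case/and3P => /and3P[-> -> ->] /andP[-> ->] ->.
have HT_eq (x y : HT M) : x p1 = y p1 -> x p2 = y p2 -> x p3 = y p3 ->
    x p4 = y p4 -> x = y.
  move=> x1 x2 x3 x4; apply/val_inj/ffunP => p /=.
  by have := fixpts_all p; rewrite !inE => /or4P[] /eqP->.
pose xi0 : {ffun fixpt M -> HBT 2} := [ffun p => if p == p2 then cls a
  else if p == p3 then cls b else if p == p4 then cls c else 0].
have xi01 : xi0 p1 = 0.
  by rewrite ffunE ![p1 == _]eq_sym (negPf n12) (negPf n13) (negPf n14).
have xi02 : xi0 p2 = cls a by rewrite ffunE eqxx.
have xi03 : xi0 p3 = cls b by rewrite ffunE (negPf n23) eqxx.
have xi04 : xi0 p4 = cls c by rewrite ffunE (negPf n24) (negPf n34) eqxx.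
have xi_cong : xi0 \in gkm_class M.
  apply/boolp.asboolP => p q u; rewrite edges => e; exists 1; rewrite mul1r.
  have {e} [e|e] := orP e.
    move: e; rewrite !inE => /or4P[|||/or3P[]] /eqP[-> -> ->];
    by rewrite ?xi01 ?xi02 ?xi03 ?xi04 ?subr0 // clsB.
  rewrite -[u]opprK clsN -opprB; congr (- _).
  move: e; rewrite !inE => /or4P[|||/or3P[]] /eqP[-> -> ->];
    by rewrite ?xi01 ?xi02 ?xi03 ?xi04 ?subr0 // clsB.
pose xi : HT M := MkHT xi_cong; exists xi; split.
  split=> [|y [_ [y1 y2 y3 y4]]]; last first.
    by apply: HT_eq; rewrite ?y1 ?y2 ?y3 ?y4.
  split=> // p; have := fixpts_all p; rewrite !inE => /or4P[] /eqP->.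
  - by rewrite xi01 rpred0.
  - by rewrite xi02 cls_homog.
  - by rewrite xi03 cls_homog.
  - by rewrite xi04 cls_homog.
have [|f fE] := @qpoly_lift _ (relpoly a b c) _ xi.
  rewrite mk_monic_relpoly.
  have xi_rel p : restr (horner_alg xi (relpoly a b c)) p = 0.
    rewrite restr_horner horner_relpoly.
    by have := fixpts_all p; rewrite !inE => /or4P[] /eqP->;
      rewrite ?xi01 ?xi02 ?xi03 ?xi04 ?subrr ?mulr0 ?mul0r.
  by apply: HT_eq; rewrite xi_rel ffunE.
have fqE (q : {poly %/ relpoly a b c}) : f q = horner_alg xi (q : {poly HBT 2}).
  by rewrite -fE; congr (f _); exact/esym/val_inj/in_qpoly_small/size_mk_monic.
exists f; split; last by rewrite fE horner_algX.
have f_inj : injective f.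
  apply: raddf_inj => q fq0; apply/val_inj => /=.
  have root_q p : root (q : {poly HBT 2}) (xi p).
    by rewrite rootE -restr_horner -fqE fq0 ffunE.
  apply: (@roots_geq_poly_eq0 _ _ [:: 0; cls a; cls b; cls c]).
  - by rewrite /= -{1}xi01 -{1}xi02 -{1}xi03 -{1}xi04 !root_q.
  - rewrite /= !inE !negb_or !andbT ![0 == _]eq_sym !cls_eq0 a0 b0 c0.
    rewrite (eq_sym (cls a) (cls b)) (eq_sym (cls a)) (eq_sym (cls b) (cls c)).
    rewrite -(subr_eq0 (cls b)) -(subr_eq0 (cls c)) -(subr_eq0 (cls c) (cls b)).
    by rewrite -!clsB !cls_eq0 ba0 ca0 cb0.
  rewrite -ltnS; apply: leq_trans (size_mk_monic q) _.
  by rewrite mk_monic_relpoly size_quartic.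
have f_surj (y : HT M) : exists q, f q = y.
  have [q [q1 q2 q3 q4]] : exists q : {poly HBT 2}, [/\ q.[0] = y p1,
      q.[cls a] = y p2, q.[cls b] = y p3 & q.[cls c] = y p4].
    apply: newton_interpolation; rewrite -?clsB //; exact: HT_cong.
  exists (in_qpoly _ q); rewrite fE; apply: HT_eq; rewrite restr_horner /=.
  - by rewrite xi01.
  - by rewrite xi02.
  - by rewrite xi03.
  - by rewrite xi04.
have [g gK] := boolp.choice f_surj.
by exists g => //; apply: inj_can_sym gK f_inj.
Qed.
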